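(* Let $X$ and $Y$ be metrizable spaces and let $\mathcal{K}(X)$, $\mathcal{K}(Y)$ denote the sets of all compact subsets of $X$ and $Y$, respectively. Let $F\colon\mathcal{K}(X)\to\mathcal{K}(Y)$ be a map satisfying: (1) $F$ is monotone: if $K,L\in\mathcal{K}(X)$ and $K\subset L$, then $F(K)\subset F(L)$; $(2)_c$ for every countable $L\in\mathcal{K}(Y)$ there exists $K\in\mathcal{K}(X)$ with $L\subset F(K)$; $(3)_c$ if $U\subset X$ and $V\subset Y$ are non-empty open sets such that for each countable compact set $L\subset V$ there is a compact $K\subset U$ with $L\subset F(K)$, then for any open cover $\mathcal{W}$ of $U$ and any point $y\in V$ there exist a finite subfamily $\mathcal{E}\subset\mathcal{W}$ and a neighborhood $V_y$ of $y$ such that for each countable compact set $L\subset V_y$ there is a compact $K\subset\bigcup\mathcal{E}$ with $L\subset F(K)$. If $X$ is completely metrizable, then $Y$ is completely metrizable and $\mathrm{dens}\,Y\leq \mathrm{dens}\,X$.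
   Context: $\mathrm{dens}$ denotes the density (the least cardinality of a dense subset).
   Formalization: Density is taken to be at least countably infinite, so dens Y ≤ max(dens X, ℵ₀) is proved; with the literal least cardinality the claim fails for finite X, e.g. X a point, Y=[0,1], F(∅)=∅, F(X)=Y. For infinite X nothing changes. *)

(* Defs.v *)
From HB Require Import structures.
From mathcomp Require Import all_boot all_order all_algebra.
From mathcomp Require Import all_classical all_reals all_analysis.
From mathcomp Require Import Rstruct.
Set Implicit Arguments. Unset Strict Implicit. Unset Printing Implicit Defensive.
Import Order.TTheory GRing.Theory Num.Theory.
Local Open Scope classical_set_scope.
Local Open Scope ring_scope.

Definition is_metric (T : Type) (d : T -> T -> Rdefinitions.R) : Prop :=
  [/\ (forall x y, 0 <= d x y),
      (forall x y, d x y = 0 <-> x = y),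
      (forall x y, d x y = d y x) &
      (forall x y z, d x z <= d x y + d y z)].

Definition metric_induces (T : topologicalType) (d : T -> T -> Rdefinitions.R) : Prop :=
  forall A : set T, open A <->
    (forall x, A x -> exists2 e : Rdefinitions.R, 0 < e &
        forall y, d x y < e -> A y).

Definition metric_complete (T : Type) (d : T -> T -> Rdefinitions.R) : Prop :=
  forall u : nat -> T,
    (forall e : Rdefinitions.R, 0 < e -> exists N : nat,
        forall m n, (N <= m)%N -> (N <= n)%N -> d (u m) (u n) < e) ->
    exists x : T, forall e : Rdefinitions.R, 0 < e -> exists N : nat,
        forall n, (N <= n)%N -> d (u n) x < e.

Definition metrizable (T : topologicalType) : Prop :=
  exists d : T -> T -> Rdefinitions.R, is_metric d /\ metric_induces d.

Definition completely_metrizable (T : topologicalType) : Prop :=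
  exists d : T -> T -> Rdefinitions.R,
    [/\ is_metric d, metric_induces d & metric_complete d].

(* dens Y <= dens X, where dens Z = least cardinality of a dense subset of Z,
   with the standard convention that cardinal functions are infinite
   (dens Z = aleph_0 + min |D|).  Unfolded: for every dense D in X there is
   a dense E in Y with |E| <= |D| or E countable. *)
Definition dens_le (Y X : topologicalType) : Prop :=
  forall D : set X, dense D ->
    exists E : set Y, dense E /\ (countable E \/ (E #<= D)%card).

(* Main.v *)
Require Import Defs.
From HB Require Import structures.
From mathcomp Require Import all_boot all_order all_algebra.
From mathcomp Require Import all_classical all_reals all_analysis.
From mathcomp Require Import Rstruct wochoice ring lra.
Local Open Scope classical_set_scope.

(** Call (U, V) captured when every countable compact subset of V lies in some
    F(K) with K a compact subset of U. Starting from (X, Y) and covering U by balls of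
    radius 1/n, condition (3)_c yields a tree of captured pairs (U_s, V_s) in
    which V_s is covered by its children and U_s, for s of length n, is covered
    by finitely many 1/n-balls. If y_n lies in V_{s|n} along a branch, then y_n
    lies in F(K_n) with K_n a subset of U_{s|n}; by completeness the closure K
    of the union of the K_n is compact, so (y_n) has an accumulation point in
    the compact set F(K).

    Hence some V_{s|n} along each branch has a finite e-net. When the centers of
    the balls range over a dense set D, these nets form a dense set of
    cardinality at most that of the finite sequences over D, that is,
    |D| + aleph_0.

    For complete metrizability, well-order the children of each node and let a
    point z of the completion of Y descend the tree, always to the least child
    containing a neighborhood of z. The z that never get stuck converge in Y.
    Those that get stuck after n steps, with balls of radius 1/m around z inside
    the nodes passed so far, are at positive distance f(y) from each y in Y,
    since points closer than 1/m follow the same path. So Y is a G_delta in its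
    completion, and adding the oscillations of the functions 1/f to the metric
    makes it complete. Points of the completion are represented by Cauchy
    sequences. *)

Set Implicit Arguments. Unset Strict Implicit. Unset Printing Implicit Defensive.
Import Order.TTheory GRing.Theory Num.Theory.
Local Open Scope ring_scope.
Local Notation R := Rdefinitions.R.

(** * Infinite cardinals *)

Definition inj_into (T U : Type) (A : set T) (B : set U) (f : T -> U) : Prop :=
  (forall x, A x -> B (f x)) /\
  (forall x y, A x -> A y -> f x = f y -> x = y).

(** Comparability of cardinals. A maximal graph of a partial injection exhausts [A] or [B], since
    otherwise a pair of missed points could be added. *)
Lemma inj_into_total (T : Type) (A B : set T) :
  (exists f, inj_into A B f) \/ (exists f, inj_into B A f).
Proof.
pose P (G : set (T * T)) :=
  (forall p, G p -> A p.1 /\ B p.2) /\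
  (forall p q, G p -> G q -> (p.1 = q.1 <-> p.2 = q.2)).
have [|G [[GAB Ginj] Gmax]] := @Zorn_bigcup _ P.
  move=> F FP Ftot; split=> [p [X FX Xp]|p q [X FX Xp] [Y FY Yq]].
    exact: (FP _ FX).1.
  have [XY|YX] := Ftot _ _ FX FY.
    by apply: (FP _ FY).2 => //; exact: XY.
  by apply: (FP _ FX).2 => //; exact: YX.
have [domG|] := pselect (forall x, A x -> exists y, G (x, y)).
  left; have /choice[f Hf] : forall x, exists y, A x -> G (x, y).
    move=> x; have [Ax|nAx] := pselect (A x); last by exists x.
    by have [y Gxy] := domG _ Ax; exists y.
  exists f; split=> [x Ax|x y Ax Ay fxy]; first exact: (GAB _ (Hf _ Ax)).2.
  by apply/(Ginj _ _ (Hf _ Ax) (Hf _ Ay)).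
move=> /existsNP[a /not_implyP[Aa /forallNP aG]].
have [ranG|] := pselect (forall y, B y -> exists x, G (x, y)).
  right; have /choice[f Hf] : forall y, exists x, B y -> G (x, y).
    move=> x; have [Bx|nBx] := pselect (B x); last by exists x.
    by have [y Gxy] := ranG _ Bx; exists y.
  exists f; split=> [x Bx|x y Bx By fxy]; first exact: (GAB _ (Hf _ Bx)).1.
  by apply/(Ginj _ _ (Hf _ Bx) (Hf _ By)).
move=> /existsNP[b /not_implyP[Bb /forallNP bG]].
exfalso; apply: (Gmax (G `|` [set (a, b)])).
  by split=> [p Gp|/(_ (a, b) (or_intror erefl)) /aG]; [left|].
split=> [p [/GAB//|->//]|[p1 p2] [q1 q2]].
case=> [Gp|[-> ->]]; case=> [Gq|[-> ->]] //=.
- exact: (Ginj _ _ Gp Gq).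
- by split=> e; exfalso; move: Gp; rewrite e; [exact: aG|exact: bG].
- by split=> e; exfalso; move: Gq; rewrite -e; [exact: aG|exact: bG].
Qed.

Definition pairing_on (T : Type) (A : set T) (f : T -> T -> T) : Prop :=
  (forall x y, A x -> A y -> A (f x y)) /\
  (forall x y x' y', A x -> A y -> A x' -> A y' ->
     f x y = f x' y' -> x = x' /\ y = y').

(** New pairs are sent into the image of [A] under [h], which misses [A], so they cannot clash with
    the old values. *)
Lemma pairing_extend (T : Type) (A : set T) (f : T -> T -> T) (c : nat -> T)
    (h : T -> T) :
  pairing_on A f -> injective c -> (forall n, A (c n)) -> inj_into A (~` A) h ->
  exists f', pairing_on (A `|` h @` A) f' /\
             forall x y, A x -> A y -> f' x y = f x y.
Proof.
move=> [fA finj] cinj Ac [hA hinj].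
(* [q] folds the enlarged set back onto [A]: the identity on [A], the inverse of [h] on its
   image. *)
have /choice[q Hq] : forall x, exists y,
    (A x -> y = x) /\ ((h @` A) x -> A y /\ h y = x).
  move=> x; have [Ax|nAx] := pselect (A x).
    by exists x; split=> // -[z /hA + zx]; rewrite zx.
  have [[z Az zx]|nhx] := pselect ((h @` A) x); first by exists z.
  by exists x.
have qA x : (A `|` h @` A) x -> A (q x).
  by case: (Hq x) => H1 H2 [Ax|/H2[]//]; rewrite (H1 Ax).
have qinj x y : (A `|` h @` A) x -> (A `|` h @` A) y ->
    `[< A x >] = `[< A y >] -> q x = q y -> x = y.
  move=> Hx Hy exy; have xy := asbool_eq_equiv exy.
  case: Hx => [Ax|hx].
    by rewrite (Hq x).1 // (Hq y).1 //; exact: (xy.1 Ax).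
  have [z Az zx] := hx; have nAx : ~ A x by rewrite -zx; exact: hA.
  have hy : (h @` A) y by case: Hy => // Ay; case: nAx; exact: xy.2 Ay.
  by move=> e; rewrite -((Hq x).2 hx).2 -((Hq y).2 hy).2 e.
(* Two bits remember which coordinates lie in [A], which [q] forgets; through [c] they become a tag
   in [A]. *)
pose b x : nat := `[< A x >].
pose g x y := h (f (c (b x + (b y).*2)%N) (f (q x) (q y))).
pose f' x y := if `[< A x /\ A y >] then f x y else g x y.
have f'E x y : A x -> A y -> f' x y = f x y by move=> ? ?; rewrite /f' asboolT.
have f'N x y : ~ (A x /\ A y) -> f' x y = g x y.
  by move=> ?; rewrite /f' asboolF.
have gin x y : (A `|` h @` A) x -> (A `|` h @` A) y -> (h @` A) (g x y).
  by move=> Hx Hy; exists (f (c (b x + (b y).*2)%N) (f (q x) (q y))) => //;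
    apply: (fA) => //; apply: (fA); exact: qA.
exists f'; split=> //; split=> [x y Hx Hy|x y x' y' Hx Hy Hx' Hy'].
  have [[Ax Ay]|nA] := pselect (A x /\ A y); first by left; rewrite f'E //; exact: fA.
  by right; rewrite f'N //; exact: gin.
have [[Ax Ay]|nA] := pselect (A x /\ A y);
  have [[Ax' Ay']|nA'] := pselect (A x' /\ A y').
- by rewrite !f'E //; exact: finj.
- rewrite f'E // f'N // => e; have [z /hA + ez] := gin _ _ Hx' Hy'.
  by rewrite ez -e => /(_ (fA _ _ Ax Ay)).
- rewrite f'N // f'E // => e; have [z /hA + ez] := gin _ _ Hx Hy.
  by rewrite ez e => /(_ (fA _ _ Ax' Ay')).
rewrite !f'N // => /hinj.
have Aqq u v : (A `|` h @` A) u -> (A `|` h @` A) v -> A (f (q u) (q v)).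
  by move=> Hu Hv; apply: fA; exact: qA.
move=> /(_ (fA _ _ (Ac _) (Aqq _ _ Hx Hy)) (fA _ _ (Ac _) (Aqq _ _ Hx' Hy'))).
move=> /finj[||||/cinj eb /finj[]] //; try exact: Aqq; try exact: qA.
move=> ex ey.
have [ebx eby] : `[< A x >] = `[< A x' >] /\ `[< A y >] = `[< A y' >].
  by move: eb; rewrite /b; do 4! case: `[< _ >].
by split; apply: qinj.
Qed.

(* Hessenberg's theorem, by Zorn's lemma on partial pairing functions: a
   maximal one lives on a subset of full cardinality. *)
Lemma infinite_pairing (T : Type) (c : nat -> T) : injective c ->
  exists f : T * T -> T, injective f.
Proof.
move=> cinj.
pose P (p : set T * (T -> T -> T)) := pairing_on p.1 p.2 /\ forall n, p.1 (c n).
pose R (p q : {p | P p}) := `[< (sval p).1 `<=` (sval q).1 /\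
  forall x y, (sval p).1 x -> (sval p).1 y -> (sval p).2 x y = (sval q).2 x y >].
have t0 : {p | P p}.
  have /choice[i Hi] : forall x, exists n, range c x -> c n = x.
    move=> x; have [[n _ nx]|] := pselect (range c x); first by exists n.
    by exists 0%N.
  exists (range c, fun x y => c (pickle (i x, i y))); split=> [|n /=]; last by exists n.
  split=> [x y _ _|/= x y x' y' Hx Hy Hx' Hy' /cinj]; first by exists (pickle (i x, i y)).
  by move=> /(pcan_inj pickleK)[ex ey]; rewrite -(Hi _ Hx) -(Hi _ Hy) ex ey !Hi.
have [|||[[A f] /= Pp] Amax] := @ZL_preorder _ t0 R.
- by move=> p; apply/asboolP; split.
- move=> q p r /asboolP[pq pqE] /asboolP[qr qrE]; apply/asboolP; split.
    exact: subset_trans qr.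
  by move=> x y px py; rewrite pqE // qrE //; exact: pq.
- move=> F Ftot; have [[s0 Fs0]|F0] := pselect (exists s, F s); last first.
    by exists t0 => s Fs; case: F0; exists s.
  pose A := \bigcup_(s in F) (sval s).1.
  have common x y : A x -> A y -> exists2 s, F s & (sval s).1 x /\ (sval s).1 y.
    move=> [s Fs sx] [t Ft ty].
    have [/asboolP[st _]|/asboolP[ts _]] := Ftot _ _ Fs Ft.
      by exists t => //; split=> //; exact: st.
    by exists s => //; split=> //; exact: ts.
  have agree s t x y : F s -> F t -> (sval s).1 x -> (sval s).1 y ->
      (sval t).1 x -> (sval t).1 y -> (sval s).2 x y = (sval t).2 x y.
    move=> Fs Ft sx sy tx ty.
    by have [/asboolP[_ ->]|/asboolP[_ <-]] := Ftot _ _ Fs Ft.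
  have /choice[f Hf] : forall p : T * T, exists z, forall s, F s ->
      (sval s).1 p.1 -> (sval s).1 p.2 -> z = (sval s).2 p.1 p.2.
    move=> [x y] /=.
    have [[s [Fs sx sy]]|no] :=
        pselect (exists s, [/\ F s, (sval s).1 x & (sval s).1 y]).
      by exists ((sval s).2 x y) => t Ft tx ty; exact: agree.
    by exists x => s Fs sx sy; case: no; exists s.
  have PA : P (A, fun x y => f (x, y)).
    split=> /= [|n]; last by exists s0 => //; exact: (proj2_sig s0).2.
    split=> [x y Ax Ay|x y x' y' Ax Ay Ax' Ay'].
      have [s Fs [sx sy]] := common _ _ Ax Ay; exists s => //.
      by rewrite (Hf (x, y) s) //; exact: (proj2_sig s).1.1.
    have [s Fs [sx sy]] := common _ _ Ax Ay.
    have [t Ft [tx ty]] := common _ _ Ax' Ay'.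
    rewrite (Hf (x, y) s) // (Hf (x', y') t) //=.
    have [/asboolP[st stE]|/asboolP[ts tsE]] := Ftot _ _ Fs Ft.
      rewrite stE //; apply: (proj2_sig t).1.2 => //; exact: st.
    rewrite tsE //; apply: (proj2_sig s).1.2 => //; exact: ts.
  exists (exist _ _ PA) => s Fs; apply/asboolP; split=> /= [x sx|x y sx sy].
    by exists s.
  by rewrite (Hf (x, y) s).
have [[fA finj] Ac] := Pp; rewrite /= in fA finj Ac.
(* If [A] embeds in its complement, [pairing_extend] contradicts maximality. Otherwise the
   complement embeds in [A], and so does all of [T], by [k] with the tags [c 0] and [c 1]. *)
have [[h hinj]|[h [hA hinj]]] := inj_into_total A (~` A).
  have [f' [f'P f'E]] := pairing_extend Pp.1 cinj Ac hinj.
  have Pf' : P (A `|` h @` A, f') by split=> // n; left.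
  have /Amax/asboolP[/= sub _] : R (exist _ _ Pp) (exist _ _ Pf').
    apply/asboolP; split=> /= [|x y Ax Ay]; first exact: subsetUl.
    by rewrite f'E.
  exfalso; apply: (hinj.1 _ (Ac 0%N)); apply: sub; right.
  by exists (c 0%N).
pose k x := if `[< A x >] then f (c 0%N) x else f (c 1%N) (h x).
have kA x : A (k x).
  rewrite /k; case: asboolP => Ax; first exact: fA.
  by apply: fA => //; exact: hA.
have kinj : injective k.
  move=> x y; rewrite /k; case: asboolP => Ax; case: asboolP => Ay e.
  - by have [] := finj _ _ _ _ (Ac _) Ax (Ac _) Ay e.
  - by have [/cinj] := finj _ _ _ _ (Ac _) Ax (Ac _) (hA _ Ay) e.
  - by have [/cinj] := finj _ _ _ _ (Ac _) (hA _ Ax) (Ac _) Ay e.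
  - have [_] := finj _ _ _ _ (Ac _) (hA _ Ax) (Ac _) (hA _ Ay) e.
    exact: hinj.
exists (fun p => f (k p.1) (k p.2)) => -[x y] [x' y'] /= /finj.
by move=> /(_ (kA _) (kA _) (kA _) (kA _)) [/kinj-> /kinj->].
Qed.

(** [code] separates lists of equal length; the length is added as a first coordinate. *)
Lemma infinite_seq_inj (T : Type) (c : nat -> T) : injective c ->
  exists f : seq T -> T, injective f.
Proof.
move=> cinj; have [f finj] := infinite_pairing cinj.
pose fix code (s : seq T) : T := if s is x :: s' then f (x, code s') else c 0%N.
have codeinj s t : size s = size t -> code s = code t -> s = t.
  elim: s t => [|x s IH] [|y t] //= [st] /finj[-> e].
  by rewrite (IH t).
exists (fun s => f (c (size s), code s)) => s t /finj[/cinj]; exact: codeinj.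
Qed.

(** * Complete metrics from gauges *)

Definition cauchy_for (T : Type) (d : T -> T -> R) (u : nat -> T) : Prop :=
  forall e : R, 0 < e -> exists N : nat,
    forall m n, (N <= m)%N -> (N <= n)%N -> d (u m) (u n) < e.

Definition converges_for (T : Type) (d : T -> T -> R) (u : nat -> T) (x : T) :
    Prop :=
  forall e : R, 0 < e -> exists N : nat, forall n, (N <= n)%N -> d (u n) x < e.

Lemma metric_refl (T : Type) (d : T -> T -> R) (x : T) : is_metric d -> d x x = 0.
Proof. by case=> _ dE _ _; apply/dE. Qed.

Lemma metric_induces_equiv (T : topologicalType) (d d' : T -> T -> R) :
  metric_induces d ->
  (forall x e, 0 < e -> exists2 e', 0 < e' & forall y, d' x y < e' -> d x y < e) ->
  (forall x e, 0 < e -> exists2 e', 0 < e' & forall y, d x y < e' -> d' x y < e) ->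
  metric_induces d'.
Proof.
move=> dT d'd dd' A; rewrite dT.
split=> H x /H[e e0 He].
  have [e' e'0 He'] := d'd x e e0; exists e' => // y /He'; exact: He.
have [e' e'0 He'] := dd' x e e0; exists e' => // y /He'; exact: He.
Qed.

Lemma natSinv_lt (e : R) : 0 < e -> exists n : nat, n.+1%:R^-1 < e.
Proof.
move=> e0; have /archi_boundP : 0 <= e^-1 by rewrite invr_ge0 ltW.
set n := Num.bound _ => en; exists n.
rewrite invf_plt ?posrE //; apply: lt_trans en _.
by rewrite ltr_nat.
Qed.

Section gauge_metric.
Variables (T : topologicalType) (d : T -> T -> R) (f : nat -> T -> R).
Hypothesis d_metric : is_metric d.
Hypothesis d_induces : metric_induces d.
Hypothesis f_gt0 : forall i x, 0 < f i x.
Hypothesis f_lip : forall i x y, f i x <= f i y + d x y.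

(** Truncation makes the supremum finite and leaves only finitely many [i] to control near a
    point. *)
Let gap i x y := Num.min (i.+1%:R^-1 : R) `|(f i x)^-1 - (f i y)^-1|.
Let sgap x y := sup (range (fun i => gap i x y)).
Let rho x y := d x y + sgap x y.

Let gap_ge0 i x y : 0 <= gap i x y.
Proof. by rewrite /gap le_min normr_ge0 invr_ge0 ler0n. Qed.

Let gap_lesgap i x y : gap i x y <= sgap x y.
Proof.
apply: ub_le_sup; last by exists i.
exists 1 => _ [j _ <-]; rewrite /gap ge_min; apply/orP; left.
by rewrite invf_le1 ?ltr0n // ler1n.
Qed.

Let sgap_le x y c : (forall i, gap i x y <= c) -> sgap x y <= c.
Proof.
by move=> H; apply: ge_sup; [exists (gap 0 x y); exists 0%N|move=> _ [i _ <-]].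
Qed.

Let sgap_ge0 x y : 0 <= sgap x y.
Proof. exact: le_trans (gap_ge0 0 x y) (gap_lesgap 0 x y). Qed.

Let gap_triangle i x y z : gap i x z <= gap i x y + gap i y z.
Proof.
have := ler_distD (f i y)^-1 (f i x)^-1 (f i z)^-1.
have c0 : 0 <= i.+1%:R^-1 :> R by rewrite invr_ge0 ler0n.
rewrite /gap; move: c0 (normr_ge0 ((f i x)^-1 - (f i y)^-1))
  (normr_ge0 ((f i y)^-1 - (f i z)^-1)).
move: (i.+1%:R^-1) `|_ - _| `|_ - _| `|_ - _| => c p q r.
by case: (leP c q); case: (leP c p); case: (leP c r) => *; lra.
Qed.

Let rho_metric : is_metric rho.
Proof.
have [d0 dE dC dD] := d_metric; split=> [x y|x y|x y|x y z]; rewrite /rho.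
- by rewrite addr_ge0.
- split=> [e|<-].
    by apply/dE; have := d0 x y; have := sgap_ge0 x y; lra.
  rewrite (dE x x).2 // add0r; apply/eqP; rewrite eq_le sgap_ge0 andbT.
  by apply: sgap_le => i; rewrite /gap subrr normr0 ge_min lexx orbT.
- rewrite dC; congr (_ + sup _); apply: eq_imagel => i _.
  by rewrite /gap distrC.
- have : sgap x z <= sgap x y + sgap y z.
    apply: sgap_le => i; apply: le_trans (gap_triangle i x y z) _.
    by apply: lerD.
  by have := dD x y z; lra.
Qed.

Let inv_gauge_continuous i x e : 0 < e ->
  exists2 e', 0 < e' & forall y, d x y < e' -> `|(f i x)^-1 - (f i y)^-1| < e.
Proof.
have [d0 dE dC dD] := d_metric.
move=> e0; have fx := f_gt0 i x; set a := f i x in fx *.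
have aa0 : 0 < e * a * a / 2 by rewrite divr_gt0 // !mulr_gt0.
(* The first bound keeps [f i y] above [a / 2]; the second then makes [|f i y - a| / (a * f i y)]
   less than [e]. *)
exists (Num.min (a / 2) (e * a * a / 2)); first by rewrite lt_min aa0 divr_gt0.
move=> y; rewrite lt_min => /andP[xy1 xy2].
have := f_lip i x y; have := f_lip i y x; rewrite (dC y x) -/a => yx xy.
have fy : 0 < f i y by exact: f_gt0.
have -> : a^-1 - (f i y)^-1 = (f i y - a) / (a * f i y).
  by field; rewrite !gt_eqF.
rewrite normrM (gtr0_norm (x := _^-1)) ?invr_gt0 ?mulr_gt0 //.
rewrite ltr_pdivrMr ?mulr_gt0 //.
have /le_lt_trans -> // : `|f i y - a| <= d x y.
  by rewrite ler_norml; apply/andP; split; lra.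
apply: lt_trans xy2 _.
have -> : e * a * a / 2 = e * (a * (a / 2)) by field.
by rewrite !ltr_pM2l //; lra.
Qed.

Let inv_gauge_continuous_below N x e : 0 < e ->
  exists2 e', 0 < e' & forall i y, (i < N)%N -> d x y < e' ->
    `|(f i x)^-1 - (f i y)^-1| < e.
Proof.
move=> e0; elim: N => [|N [e' e'0 He']]; first by exists 1.
have [e'' e''0 He''] := inv_gauge_continuous N x e0.
exists (Num.min e' e''); first by rewrite lt_min e'0.
move=> i y; rewrite ltnS leq_eqVlt lt_min => /orP[/eqP->|iN] /andP[h1 h2].
  exact: He''.
exact: He'.
Qed.

Let rho_induces : metric_induces rho.
Proof.
apply: metric_induces_equiv d_induces _ _ => x e e0.
  by exists e => // y; have := sgap_ge0 x y; rewrite /rho; lra.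
have e20 : 0 < e / 2 by lra.
have e40 : 0 < e / 4 by lra.
(* From [N] on the truncation alone bounds the gap; below [N] finitely many continuity conditions
   suffice. *)
have [N HN] := natSinv_lt e40.
have [e' e'0 He'] := inv_gauge_continuous_below N x e40.
exists (Num.min e' (e / 2)); first by rewrite lt_min e'0.
move=> y; rewrite lt_min => /andP[h1 h2]; rewrite /rho.
suff : sgap x y <= e / 4 by lra.
apply: sgap_le => i; rewrite /gap ge_min; have [iN|Ni] := ltnP i N.
  by rewrite (ltW (He' _ _ iN h1)) orbT.
rewrite (le_trans _ (ltW HN)) // lef_pV2 ?posrE ?ltr0n // ler_nat.
exact: Ni.
Qed.

(* Along a rho-Cauchy sequence the numbers 1 / f i stay bounded: rho controls
   their oscillation. *)
Lemma gauges_completely_metrizable :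
  (forall u, cauchy_for d u ->
     (forall i, exists2 e, 0 < e & exists N, forall n, (N <= n)%N -> e <= f i (u n)) ->
     exists x, converges_for d u x) ->
  completely_metrizable T.
Proof.
have [d0 dE dC dD] := d_metric.
move=> lim_ex; exists rho; split=> // u u_cauchy.
have [||x ux] := lim_ex u.
- move=> e e0; have [N HN] := u_cauchy e e0; exists N => m n Nm Nn.
  by have := HN m n Nm Nn; have := sgap_ge0 (u m) (u n); rewrite /rho; lra.
- move=> i; have i0 : 0 < i.+1%:R^-1 :> R by rewrite invr_gt0 ltr0n.
  have [N HN] := u_cauchy _ i0.
  pose b : R := (f i (u N))^-1 + i.+1%:R^-1.
  have b0 : 0 < b by rewrite addr_gt0 // invr_gt0.
  exists b^-1; [by rewrite invr_gt0|exists N => n Nn].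
  have := HN n N Nn (leqnn N); have := gap_lesgap i (u n) (u N).
  have := d0 (u n) (u N); rewrite /rho => p1 p2 p3.
  (* Below its truncation level the gap is the true difference of the inverses. *)
  have : gap i (u n) (u N) < i.+1%:R^-1
    by apply: le_lt_trans p2 (le_lt_trans _ p3); rewrite lerDr.
  rewrite /gap gt_min ltxx /= ltr_norml => /andP[_ p4].
  rewrite -[f i (u n)]invrK lef_pV2 ?posrE ?invr_gt0 // /b.
  by rewrite -lerBlDl ltW.
exists x => e e0.
(* Both metrics induce the same topology, so [d]-convergence gives [rho]-convergence. *)
have [e' e'0 He'] : exists2 e', 0 < e' & forall y, d x y < e' -> rho x y < e.
  have : open [set y | rho x y < e].
    apply/rho_induces => y /= xy; exists (e - rho x y); first by lra.
    by move=> z; have [_ _ _ /(_ x y z)] := rho_metric; lra.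
  by move=> /d_induces /(_ x); apply; rewrite /= (metric_refl _ rho_metric).
have [N HN] := ux e' e'0; exists N => n Nn.
have [_ _ -> _] := rho_metric; apply: He'; rewrite dC; exact: HN.
Qed.

End gauge_metric.

(** * Sieves *)

Definition clusters_at (T : Type) (d : T -> T -> R) (u : nat -> T) (x : T) :
    Prop :=
  forall (e : R) (N : nat), 0 < e -> exists2 n, (N <= n)%N & d (u n) x < e.

Lemma cauchy_clusters (T : Type) (d : T -> T -> R) (u : nat -> T) (x : T) :
  is_metric d -> cauchy_for d u -> clusters_at d u x -> converges_for d u x.
Proof.
move=> [_ _ _ dD] u_cauchy ux e e0; have e20 : 0 < e / 2 by lra.
have [N HN] := u_cauchy _ e20; exists N => n Nn.
have [m Nm um] := ux _ N e20.
by have := HN n m Nn Nm; have := dD (u n) (u m) x; lra.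
Qed.

(** The latest choice stands at the head, so [i :: s] is a child of [s]. *)
Definition branch (I : Type) (s : nat -> seq I) : Prop :=
  s 0%N = [::] /\ forall n, exists i, s n.+1 = i :: s n.

Section sieve.
Variables (I : eqType) (T : topologicalType) (d : T -> T -> R).
Variables (V : seq I -> set T) (le : rel I).
Hypothesis d_metric : is_metric d.
Hypothesis d_induces : metric_induces d.
Hypothesis le_wo : well_order le.
Hypothesis V_nil : forall x, V [::] x.
Hypothesis V_open : forall s, open (V s).
Hypothesis V_cover : forall s x, V s x -> exists i, V (i :: s) x.
Hypothesis V_branch : forall s y, branch s -> (forall n, V (s n) (y n)) ->
  exists x, clusters_at d y x.

(* A Cauchy sequence u stands for its limit z in the completion of T;
   [inside e u A] says that the ball of radius e around z meets T within A. *)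
Let inside e u (A : set T) :=
  exists N, forall k y, (N <= k)%N -> d (u k) y < e -> A y.

(* The canonical node of each length picks at every step the least child that
   contains a neighborhood of z. *)
Fixpoint canonical e u s : Prop := if s is i :: s' then
    [/\ canonical e u s', inside e u (V s) &
        forall j e', 0 < e' -> inside e' u (V (j :: s')) -> le i j]
  else True.

Let canonical_le e e' u s : e' <= e -> canonical e u s -> canonical e' u s.
Proof.
move=> e'e; elim: s => [//|i s IH] [/IH cs [N HN] imin]; split=> //.
by exists N => k y Nk uy; apply: HN Nk _; lra.
Qed.

Let le_anti i j : le i j -> le j i -> i = j.
Proof.
move=> ij ji.
have refl k : le k k.
  have [|z [[zk zmin] _]] := le_wo (A := pred1 k); first by exists k; rewrite inE.
  by move: zk (zmin k); rewrite !inE => /eqP->; apply.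
have [|z [_ zu]] := le_wo (A := pred2 i j); first by exists i; rewrite !inE eqxx.
have <- : z = i.
  by apply: zu; split=> [|k]; rewrite !inE ?eqxx // => /orP[]/eqP->.
by apply: zu; split=> [|k]; rewrite !inE ?eqxx ?orbT // => /orP[]/eqP->.
Qed.

Let inside_close e e' u v A : inside e u A ->
  (exists N, forall k, (N <= k)%N -> d (u k) (v k) < e') -> inside (e - e') v A.
Proof.
have [d0 dE dC dD] := d_metric.
move=> [N HN] [M HM]; exists (maxn N M) => k y; rewrite geq_max => /andP[Nk Mk] vy.
by apply: HN Nk _; have := HM k Mk; have := dD (u k) (v k) y; lra.
Qed.

(** Parents agree by induction. Shrinking the radius by [e'] carries neighborhoods of either limit
    over to the other, so [i] and [j] are candidates for both sequences, and minimality gives both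
    inequalities. *)
Let canonical_unique e e' u v s t : canonical e u s -> canonical e v t ->
  size s = size t -> e' < e ->
  (exists N, forall k, (N <= k)%N -> d (u k) (v k) < e') -> s = t.
Proof.
have [d0 dE dC dD] := d_metric.
move=> + + + e'e uv.
have vu : exists N, forall k, (N <= k)%N -> d (v k) (u k) < e'.
  by have [N HN] := uv; exists N => k /HN; rewrite dC.
elim: s t => [|i s IH] [|j t] //= [cs us imin] [ct vt jmin] [st].
have est : s = t by exact: IH.
subst t; congr (_ :: _); apply: le_anti.
  by apply: imin (inside_close vt vu); lra.
by apply: jmin (inside_close us uv); lra.
Qed.

Let bad n e u := cauchy_for d u /\ exists s, [/\ size s = n, canonical e u s &
  forall i e', 0 < e' -> ~ inside e' u (V (i :: s))].

(** Says without limits, up to the case of equality, that the limit of every bad [u] has distance at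
    least [r] from [y]. *)
Let far n e y r := forall u, bad n e u -> forall N : nat,
  ~ forall k, (N <= k)%N -> d y (u k) < r.

(* Within e / 3 of y all bad sequences share the same canonical node s, which
   contains y; a child of s around y excludes all bad sequences near y. *)
Let far_ex n e y : 0 < e -> exists2 r, 0 < r & far n e y r.
Proof.
have [d0 dE dC dD] := d_metric.
move=> e0; apply: contrapT => /forall2NP noex.
have near r : 0 < r -> exists u, bad n e u /\
    exists N : nat, forall k, (N <= k)%N -> d y (u k) < r.
  move=> r0; have [//|/existsNP[u /not_implyP[bu /existsNP[N /contrapT HN]]]] := noex r.
  by exists u; split=> //; exists N.
have e30 : 0 < e / 3 by lra.
have [u [[_ [s [sn us sbad]]] [N HN]]] := near _ e30.
have Vsy : V s y.
  case: s us {sn sbad} => [//|i s] [_ [M HM] _].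
  apply: (HM (maxn M N)); rewrite ?leq_maxl // dC.
  by have := HN (maxn M N) (leq_maxr _ _); lra.
have [i Viy] := V_cover Vsy.
have [e1 e10 He1] := (d_induces _).1 (V_open (i :: s)) y Viy.
(* [e / 3] forces [v] to share the node [s] with [u]; [e1 / 2] puts a ball around the limit of [v]
   into the child [i :: s]. *)
have r0 : 0 < Num.min (e / 3) (e1 / 2) by rewrite lt_min e30 divr_gt0.
have [v [[_ [t [tn vt tbad]]] [M HM]]] := near _ r0.
have e23 : e / 3 + e / 3 < e by lra.
have est : s = t.
  apply: (canonical_unique us vt _ e23); first by rewrite sn.
  exists (maxn N M) => k; rewrite geq_max => /andP[/HN h1 /HM].
  rewrite lt_min => /andP[h2 h3].
  by have := dD (u k) y (v k); rewrite (dC _ y); lra.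
subst t; have e120 : 0 < e1 / 2 by lra.
apply: (tbad i _ e120); exists M => k w /HM; rewrite lt_min => /andP[_ h1] h2.
by apply: He1; have := dD y (v k) w; lra.
Qed.

(** The cap at 1 keeps the supremum finite even if there are no bad sequences. *)
Let radii n e y : set R := [set r | 0 <= r <= 1 /\ far n e y r].
Let dist_bad n e y := sup (radii n e y).

Let far_le n e y y' r r' : far n e y r -> r' + d y y' <= r -> far n e y' r'.
Proof.
have [d0 dE dC dD] := d_metric.
move=> Hr r'r u bu N HN; apply: (Hr u bu N) => k /HN.
by have := dD y y' (u k); lra.
Qed.

Let radii_sup n e y : has_sup (radii n e y).
Proof.
have [d0 dE dC dD] := d_metric.
split; last by exists 1 => r [/andP[]].
exists 0; split; first by rewrite lexx ler01.
by move=> u bu N /(_ N (leqnn N)); rewrite ltNge d0.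
Qed.

Let dist_bad_gt0 n e y : 0 < e -> 0 < dist_bad n e y.
Proof.
move=> e0; have [r r0 Hr] := far_ex n y e0.
have m0 : 0 < Num.min r 1 by rewrite lt_min r0 ltr01.
apply: lt_le_trans (m0) _; apply: sup_upper_bound; first exact: radii_sup.
split; first by apply/andP; split; [exact: ltW|rewrite ge_min lexx orbT].
apply: far_le Hr _; rewrite (metric_refl _ d_metric) addr0.
by rewrite ge_min lexx.
Qed.

Let dist_bad_lip n e x y : dist_bad n e x <= dist_bad n e y + d x y.
Proof.
have [d0 dE dC dD] := d_metric.
apply: ge_sup => [|r [/andP[r0 r1] Hr]]; first exact: (radii_sup n e x).1.
have ub := sup_upper_bound (radii_sup n e y).
rewrite -lerBlDr; have [h|h] := leP 0 (r - d x y); last first.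
  apply: le_trans (ltW h) _; apply: ub; split; first by rewrite lexx ler01.
  by move=> u bu N /(_ N (leqnn N)); rewrite ltNge d0.
apply: ub; split; first by rewrite h; have := d0 x y; lra.
by apply: far_le Hr _; rewrite subrK.
Qed.

(** A bad sequence is eventually within [r / 2] of each of its late terms, where the gauge thus
    cannot reach [r]. *)
Let dist_bad_pos n e u : cauchy_for d u ->
  (exists2 r, 0 < r & exists N, forall k, (N <= k)%N -> r <= dist_bad n e (u k)) ->
  ~ bad n e u.
Proof.
move=> u_cauchy [r r0 [N HN]] bu; have r20 : 0 < r / 2 by lra.
have [M HM] := u_cauchy _ r20.
have := HN (maxn N M) (leq_maxl _ _).
have [r' [_ Hr'] r'r] := sup_adherent r20 (radii_sup n e (u (maxn N M))).
rewrite -/(dist_bad n e _) in r'r => rdist.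
apply: (Hr' u bu M) => k Mk.
by have := HM _ k (leq_maxr N M) Mk; lra.
Qed.

(** Not being bad for some [1 / (m + 1)] below the current radius yields a child around the limit;
    the least such child continues the path. *)
Let canonical_ex u : (forall n m, ~ bad n m.+1%:R^-1 u) -> cauchy_for d u ->
  forall n, exists s, size s = n /\ exists2 e, 0 < e & canonical e u s.
Proof.
move=> good u_cauchy; elim=> [|n [s [sn [e e0 us]]]].
  by exists [::]; split=> //; exists 1.
have [m me] := natSinv_lt e0.
have [i0 Hi0] : exists i, exists2 e', 0 < e' & inside e' u (V (i :: s)).
  apply: contrapT => no; apply: (good n m); split=> //; exists s; split=> //.
    exact: canonical_le (ltW me) us.
  by move=> i e' e'0 He'; apply: no; exists i, e'.
pose A := [pred i | `[< exists2 e', 0 < e' & inside e' u (V (i :: s)) >]].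
have [|i [[iA imin] _]] := le_wo (A := A); first by exists i0; apply/asboolP.
have [e' e'0 [N HN]] := asboolP _ iA.
exists (i :: s); split; first by rewrite /= sn.
exists (Num.min e e'); first by rewrite lt_min e0.
split.
- by apply: canonical_le us; rewrite ge_min lexx.
- by exists N => k y Nk; rewrite lt_min => /andP[_]; exact: HN.
- by move=> j e'' e''0 Hj; apply: imin; apply/asboolP; exists e''.
Qed.

Lemma sieve_sub_completely_metrizable : completely_metrizable T.
Proof.
have [d0 dE dC dD] := d_metric.
(* Pairs of a step count and a radius index are enumerated by naturals; the default merely repeats a
   gauge. *)
pose idx i : nat * nat := odflt (0, 0)%N (unpickle i).
pose f i := dist_bad (idx i).1 ((idx i).2.+1%:R^-1).
apply: (gauges_completely_metrizable (f := f) d_metric d_induces).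
- by move=> i x; apply: dist_bad_gt0; rewrite invr_gt0 ltr0n.
- by move=> i x y; exact: dist_bad_lip.
move=> u u_cauchy u_pos.
have good n m : ~ bad n m.+1%:R^-1 u.
  apply: dist_bad_pos u_cauchy _; have := u_pos (pickle (n, m)).
  by rewrite /f /idx pickleK.
have /choice[s Hs] := canonical_ex good u_cauchy.
have s_branch : branch s.
  split=> [|n]; first by case: (Hs 0%N) => /eqP; rewrite size_eq0 => /eqP.
  have [sn [e e0 es]] := Hs n; have [sn1 [e' e'0 es1]] := Hs n.+1.
  case: (s n.+1) sn1 es1 => [//|i t] [tn] [et _ _]; exists i.
  congr (_ :: _); have m0 : 0 < Num.min e e' by rewrite lt_min e0.
  apply: (canonical_unique (e := Num.min e e') (e' := Num.min e e' / 2)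
    (u := u) (v := u)); rewrite ?sn //; last 2 first.
  - by lra.
  - by exists 0%N => k _; rewrite (metric_refl _ d_metric); lra.
  - by apply: canonical_le et; rewrite ge_min lexx orbT.
  - by apply: canonical_le es; rewrite ge_min lexx.
(* Since [n <= k n], an accumulation point of the chosen terms is one of [u]. *)
have /choice[k Hk] : forall n, exists k, (n <= k)%N /\ V (s n) (u k).
  move=> n; have [_ [e e0 es]] := Hs n.
  case: (s n) es => [|i t]; first by exists n; split=> //; exact: V_nil.
  move=> [_ [N HN] _]; exists (maxn n N); split; first exact: leq_maxl.
  apply: (HN (maxn n N)); first exact: leq_maxr.
  by rewrite (metric_refl _ d_metric).
have [x ux] := V_branch s_branch (fun n => (Hk n).2).
exists x; apply: cauchy_clusters => // e N e0.
have [n Nn un] := ux e N e0; exists (k n) => //.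
exact: leq_trans Nn (Hk n).1.
Qed.
End sieve.

(** * Compactness in metric spaces *)

Lemma open_metric_ball (T : topologicalType) (d : T -> T -> R) (x : T) (e : R) :
  is_metric d -> metric_induces d -> open [set y | d x y < e].
Proof.
move=> [_ _ _ dD] dT; apply/dT => y /= xy; exists (e - d x y); first by lra.
by move=> z yz; have := dD x y z; lra.
Qed.

Lemma nbhs_metric_ball (T : topologicalType) (d : T -> T -> R) (x : T) (A : set T) :
  metric_induces d -> nbhs x A -> exists2 e, 0 < e & forall y, d x y < e -> A y.
Proof.
move=> dT; rewrite nbhsE => -[B [/dT Bo Bx] BA].
by have [e e0 He] := Bo x Bx; exists e => // y /He/BA.
Qed.

Lemma compact_clusters (T : topologicalType) (d : T -> T -> R) (K : set T)
    (u : nat -> T) :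
  is_metric d -> metric_induces d -> compact K -> (forall n, K (u n)) ->
  exists x, clusters_at d u x.
Proof.
move=> dm dT Kc uK; have [|x [Kx ux]] := Kc (u @ \oo) _.
  by exists 0%N => // n _; exact: uK.
exists x => e N e0; have [_ _ dC _] := dm.
have [||y [[n /= Nn <-]]] := ux [set u n | n in [set n | (N <= n)%N]]
    [set y | d x y < e].
- by exists N => // n /= Nn; exists n.
- apply: open_nbhs_nbhs; split; first exact: open_metric_ball.
  by rewrite /= (metric_refl _ dm).
by rewrite /= dC => h; exists n.
Qed.

Definition finite_net (T : eqType) (d : T -> T -> R) (A : set T) (e : R)
    (t : seq T) : Prop :=
  forall x, A x -> exists2 c, c \in t & d c x < e.

(* Otherwise a greedily chosen e-separated sequence has no accumulation point. *)
Lemma clusters_finite_net (T : eqType) (d : T -> T -> R) (A : nat -> set T)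
    (e : R) :
  is_metric d -> 0 < e ->
  (forall u, (forall n, A n (u n)) -> exists x, clusters_at d u x) ->
  exists n t, finite_net d (A n) e t.
Proof.
move=> [_ _ dC dD] e0 Aacc; apply: contrapT => nonet.
have /choice[g Hg] : forall p : seq T * nat, exists x,
    A p.2 x /\ forall c, c \in p.1 -> e <= d c x.
  move=> [t n] /=; apply: contrapT => no; apply: nonet; exists n, t => x Ax.
  apply: contrapT => nox; apply: no; exists x; split=> // c ct.
  by rewrite leNgt; apply/negP => h; apply: nox; exists c.
(* [L n] lists the points chosen before stage [n]; the next one, [u n], lies in [A n] at distance at
   least [e] from them. *)
pose fix L n := if n is m.+1 then g (L m, m) :: L m else [::].
pose u n := g (L n, n).
have uL i n : (i < n)%N -> u i \in L n.
  elim: n => [//|n IH]; rewrite ltnS leq_eqVlt => /orP[/eqP->|/IH].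
    exact: mem_head.
  by rewrite /= inE => ->; rewrite orbT.
have e20 : 0 < e / 2 by lra.
have [x ux] := Aacc u (fun n => (Hg (L n, n)).1).
have [m _ um] := ux _ 0%N e20; have [n mn un] := ux _ m.+1 e20.
have := (Hg (L n, n)).2 _ (uL _ _ mn); rewrite -/(u n) /=.
by have := dD (u m) x (u n); rewrite (dC x); lra.
Qed.

Lemma compact_finite_net (T : topologicalType) (d : T -> T -> R) (K : set T)
    (e : R) :
  is_metric d -> metric_induces d -> compact K -> 0 < e ->
  exists t, finite_net d K e t.
Proof.
move=> dm dT Kc e0; have [u uK|_ [t Ht]] := clusters_finite_net
    (A := fun _ => K) dm e0; last by exists t.
exact: compact_clusters dm dT Kc uK.
Qed.

(** An ultrafilter containing the closure of [S] contains a ball of each radius [1 / (n + 1)]; the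
    centers form a Cauchy sequence, and the ultrafilter converges to their limit. *)
Lemma totally_bounded_closure_compact (T : topologicalType) (d : T -> T -> R)
    (S : set T) :
  is_metric d -> metric_induces d -> metric_complete d ->
  (forall e, 0 < e -> exists t, finite_net d S e t) ->
  compact [set x | forall e, 0 < e -> exists2 y, S y & d x y < e].
Proof.
move=> dm dT dcomp Stb; have [d0 dE dC dD] := dm.
set K := [set x | _]; rewrite compact_ultra => F Fu FK.
have small e : 0 < e -> exists c, F [set x | d c x < e].
  move=> e0; have e20 : 0 < e / 2 by lra.
  have [t Ht] := Stb _ e20.
  have Kt : K `<=` [set x | exists2 c, c \in t & d c x < e].
    move=> x /(_ _ e20)[y Sy xy]; have [c ct cy] := Ht y Sy.
    by exists c => //; have := dD c y x; rewrite (dC y x); lra.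
  have : F [set x | exists2 c, c \in t & d c x < e] by exact: filterS FK.
  elim: t {Ht Kt} => [|c t IH] Ft.
    by have [x [c]] := filter_ex Ft.
  have [Fc|Fc] := in_ultra_setVsetC [set x | d c x < e] Fu; first by exists c.
  apply: IH; apply: filterS (filterI Ft Fc) => x [[b]].
  by rewrite inE => /orP[/eqP->|bt] // bx _; exists b.
have /choice[c Hc] : forall n : nat, exists c, F [set x | d c x < n.+1%:R^-1].
  by move=> n; apply: small; rewrite invr_gt0 ltr0n.
have close m n : d (c m) (c n) < m.+1%:R^-1 + n.+1%:R^-1.
  have [x [/= h1 h2]] := filter_ex (filterI (Hc m) (Hc n)).
  by apply: le_lt_trans (dD _ x _) _; rewrite (dC x) ltrD.
have inv_le m n : (m <= n)%N -> n.+1%:R^-1 <= m.+1%:R^-1 :> R.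
  by move=> mn; rewrite lef_pV2 ?posrE ?ltr0n // ler_nat.
have [e e0|x cx] := dcomp c.
  have e20 : 0 < e / 2 by lra.
  have [N HN] := natSinv_lt e20; exists N => m n Nm Nn.
  apply: lt_le_trans (close m n) _.
  have -> : e = e / 2 + e / 2 by lra.
  by apply: lerD; apply: le_trans (inv_le _ _ _) (ltW HN).
have Fx e : 0 < e -> F [set y | d x y < e].
  move=> e0; have e20 : 0 < e / 2 by lra.
  have [N HN] := natSinv_lt e20; have [M HM] := cx _ e20.
  apply: filterS (Hc (maxn N M)) => y /= h.
  have := lt_le_trans h (le_trans (inv_le _ _ (leq_maxl _ _)) (ltW HN)).
  have := HM _ (leq_maxr N M); have := dD x (c (maxn N M)) y.
  by rewrite (dC x (c _)); lra.
exists x; split=> [e e0|A /(nbhs_metric_ball dT)[e e0 He]]; last first.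
  exact: filterS He (Fx e e0).
have e20 : 0 < e / 2 by lra.
have [w [/(_ _ e20)[y Sy wy] /= xw]] := filter_ex (filterI FK (Fx _ e20)).
by exists y => //; have := dD x w y; lra.
Qed.

(** * The sieve of captured pairs *)

Section compact_valued_sieve.
Variables (X Y : topologicalType) (dX : X -> X -> R) (dY : Y -> Y -> R).
Hypothesis dX_metric : is_metric dX.
Hypothesis dX_induces : metric_induces dX.
Hypothesis dX_complete : metric_complete dX.
Hypothesis dY_metric : is_metric dY.
Hypothesis dY_induces : metric_induces dY.
Variable F : set X -> set Y.
Hypothesis F_compact : forall K : set X, compact K -> compact (F K).
Hypothesis F_mono : forall K L : set X,
  compact K -> compact L -> K `<=` L -> F K `<=` F L.
Hypothesis F_2c : forall L : set Y, compact L -> countable L ->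
  exists K : set X, compact K /\ L `<=` F K.

Definition captures (U : set X) (V : set Y) : Prop :=
  forall L : set Y, compact L -> countable L -> L `<=` V ->
    exists K : set X, [/\ compact K, K `<=` U & L `<=` F K].

Hypothesis F_3c : forall (U : set X) (V : set Y), open U -> open V ->
  U !=set0 -> V !=set0 -> captures U V ->
  forall W : set (set X), (forall A, W A -> open A) ->
    U `<=` \bigcup_(A in W) A ->
  forall y : Y, V y ->
    exists (E : set (set X)) (Vy : set Y),
      [/\ finite_set E, E `<=` W, nbhs y Vy &
          captures (\bigcup_(A in E) A) Vy].

Variables (J : eqType) (p : J -> X).
Hypothesis p_dense : dense (range p).

(** Labels are finite lists of centers instead of open sets, so that the nodes can be counted in
    terms of [J]. *)
Fixpoint node_dom (s : seq (seq J)) : set X := if s is l :: s' then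
    node_dom s' `&` [set x | exists2 j, j \in l & dX (p j) x < (size s').+1%:R^-1]
  else setT.

(** Taking the union of all captured open sets makes the result depend on [s] alone; each of its
    points still has a captured neighborhood, which suffices below. *)
Definition node_img (s : seq (seq J)) : set Y :=
  [set y | exists V, [/\ open V, V y & captures (node_dom s) V]].

Let node_dom_open s : open (node_dom s).
Proof.
elim: s => [|l s IH] /=; first exact: openT.
apply: openI => //; apply/dX_induces => x [j jl jx].
have [e e0 He] := (dX_induces _).1
  (open_metric_ball (p j) (size s).+1%:R^-1 dX_metric dX_induces) x jx.
by exists e => // z /He; exists j.
Qed.

Lemma node_img_open s : open (node_img s).
Proof.
apply/dY_induces => y [V [Vo Vy sV]].
have [e e0 He] := (dY_induces _).1 Vo y Vy.
by exists e => // z /He Vz; exists V.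
Qed.

Lemma node_img_nil y : node_img [::] y.
Proof.
exists setT; split=> //; first exact: openT.
by move=> L Lc Lct _; have [K [Kc LK]] := F_2c Lc Lct; exists K.
Qed.

Lemma node_img_cover s y : node_img s y -> exists l, node_img (l :: s) y.
Proof.
have [_ _ dXC _] := dX_metric; move=> [V [Vo Vy sV]].
have [[x0 sx0]|s0] := pselect (node_dom s !=set0); last first.
  (* Over an empty domain (3)_c does not apply, but there [K] is empty, so the empty list of centers
     serves. *)
  exists [::], V; split=> // L Lc Lct LV; have [K [Kc Ks LK]] := sV L Lc Lct LV.
  by exists K; split=> // x /Ks sx; case: s0; exists x.
pose e : R := (size s).+1%:R^-1.
have e0 : 0 < e by rewrite invr_gt0 ltr0n.
pose B j := node_dom s `&` [set x | dX (p j) x < e].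
have near x : exists j, dX (p j) x < e.
  have [||z [/= xz [j _ jE]]] := p_dense (O := [set z | dX x z < e]).
  - by exists x; rewrite /= (metric_refl _ dX_metric).
  - exact: open_metric_ball.
  - by exists j; rewrite jE dXC.
have [j0 _] := near x0.
have [_ [j _ <-]|x sx|E [Vy0 [Efin EW Vy0y EV]]] := F_3c (node_dom_open s) Vo
    (ex_intro _ x0 sx0) (ex_intro _ y Vy) sV (W := range B) _ _ Vy.
- by apply: openI; [exact: node_dom_open|exact: open_metric_ball].
- by have [j xj] := near x; exists (B j); [exists j|split].
(* [jf] recovers a center for each set of the cover; [j0] is a dummy value elsewhere. *)
have /choice[jf Hjf] : forall A, exists j, range B A -> B j = A.
  move=> A; have [[j _ jA]|no] := pselect (range B A); first by exists j.
  by exists j0.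
have /finite_seqP[es esE] := Efin.
have El : \bigcup_(A in E) A `<=` node_dom ([seq jf A | A <- es] :: s).
  move=> x [A EA]; rewrite -(Hjf _ (EW _ EA)) => -[sx xA]; split=> //.
  by exists (jf A) => //; apply: map_f; move: EA; rewrite esE.
exists [seq jf A | A <- es], (interior Vy0); split=> //; first exact: open_interior.
move=> L Lc Lct LV; have [] := EV L Lc Lct.
  exact: subset_trans LV (@interior_subset _ _).
by move=> K [Kc KE LK]; exists K; split=> //; exact: subset_trans El.
Qed.

Lemma branch_clusters s y : branch s -> (forall n, node_img (s n) (y n)) ->
  exists x, clusters_at dY y x.
Proof.
have [dX0 dXE dXC dXD] := dX_metric.
move=> [s0 sS] sy.
have size_s n : size (s n) = n.
  by elim: n => [|n IH]; [rewrite s0|have [l ->] := sS n; rewrite /= IH].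
have sub m n : node_dom (s (n + m)%N) `<=` node_dom (s m).
  elim: n => [//|n IH]; have [l] := sS (n + m)%N; rewrite addSn => -> x [+ _].
  exact: IH.
have /choice[K HK] : forall n, exists K,
    [/\ compact K, K `<=` node_dom (s n) & F K (y n)].
  move=> n; have [V [_ Vy sV]] := sy n.
  have [||_ ->//|K [Kc Ks yK]] := sV [set y n].
  - exact: compact_set1.
  - by apply: finite_set_countable; exact: finite_set1.
  by exists K; split=> //; exact: yK.
pose S := \bigcup_n K n.
have Stb e : 0 < e -> exists t, finite_net dX S e t.
  move=> e0; have [N HN] := natSinv_lt e0.
  (* The [K n] with [n <= N] have a common finite net; the later ones lie in the domain of [s N.+1],
     covered by finitely many balls of radius [1 / (N + 1) < e]. *)
  have [t1 Ht1] : exists t, finite_net dX (\bigcup_(n in `I_N.+1) K n) e t.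
    elim: N.+1 => [|n [t Ht]]; first by exists [::] => x [].
    have [Kn _ _] := HK n; have [t' Ht'] := compact_finite_net dX_metric dX_induces Kn e0.
    exists (t ++ t') => x [m /=]; rewrite ltnS leq_eqVlt => /orP[/eqP->|mn] Kx.
      by have [c ct cx] := Ht' x Kx; exists c; rewrite // mem_cat ct orbT.
    by have [|c ct cx] := Ht x; [exists m|exists c; rewrite // mem_cat ct].
  have [l lE] := sS N.
  exists (t1 ++ [seq p j | j <- l]) => x [n _ Kx].
  have [nN|Nn] := leqP n N.
    by have [|c ct cx] := Ht1 x; [exists n|exists c; rewrite // mem_cat ct].
  have [_ Kns _] := HK n.
  have : node_dom (s N.+1) x.
    by apply: (sub _ (n - N.+1)%N); rewrite subnK //; exact: Kns.
  rewrite lE /= size_s => -[_ [j jl jx]]; exists (p j).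
    by rewrite mem_cat map_f ?orbT.
  exact: lt_trans jx HN.
(* Monotonicity puts all [y n] into the image under [F] of one compact set, the closure of [S]. *)
have Kc := totally_bounded_closure_compact dX_metric dX_induces dX_complete Stb.
apply: compact_clusters dY_metric dY_induces (F_compact Kc) _ => n.
have [Knc _ yK] := HK n; apply: F_mono Knc Kc _ _ yK => x Kx e e0.
by exists x; [exists n|rewrite (metric_refl _ dX_metric)].
Qed.

(** Following children that contain [y] gives a branch; by [branch_clusters] and
    [clusters_finite_net] one of its nodes has a finite net. *)
Lemma node_img_finite_net y e : 0 < e ->
  exists s t, node_img s y /\ finite_net dY (node_img s) e t.
Proof.
move=> e0.
have /choice[g Hg] : forall s, exists l, node_img s y -> node_img (l :: s) y.
  move=> s; have [/node_img_cover[l ly]|no] := pselect (node_img s y).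
    by exists l.
  by exists [::] => /no.
pose fix s n := if n is m.+1 then g (s m) :: s m else [::].
have sy n : node_img (s n) y.
  by elim: n => [|n IH]; [exact: node_img_nil|exact: Hg].
have s_branch : branch s by split=> // n; exists (g (s n)).
have [u uA|n [t Ht]] := clusters_finite_net (A := fun n => node_img (s n))
    dY_metric e0.
  exact: branch_clusters s_branch uA.
by exists (s n), t.
Qed.

Lemma image_completely_metrizable : completely_metrizable Y.
Proof.
have [le le_wo] := well_ordering_principle (seq J).
apply: (sieve_sub_completely_metrizable dY_metric dY_induces le_wo).
- exact: node_img_nil.
- exact: node_img_open.
- exact: node_img_cover.
- exact: branch_clusters.
Qed.

(** A point of [E] is coded by the index of a net containing it and its position in that net. *)
Lemma dense_nets : exists E : set Y, dense E /\
  exists h : Y -> seq (seq J) * nat * nat, {in E &, injective h}.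
Proof.
have /choice[t Ht] : forall q : seq (seq J) * nat, exists t,
    (exists t', finite_net dY (node_img q.1) q.2.+1%:R^-1 t') ->
    finite_net dY (node_img q.1) q.2.+1%:R^-1 t.
  move=> q; have [[t' Ht']|no] := pselect (exists t', finite_net dY
    (node_img q.1) q.2.+1%:R^-1 t'); first by exists t'.
  by exists [::] => /no.
exists [set z | exists q, z \in t q]; split=> [G [y Gy] /dY_induces /(_ y Gy)|].
  move=> [e e0 He]; have [m me] := natSinv_lt e0.
  have m0 : 0 < m.+1%:R^-1 :> R by rewrite invr_gt0 ltr0n.
  have [s [t' [sy Ht']]] := node_img_finite_net y m0.
  have /Ht net : exists t', finite_net dY (node_img (s, m).1) (s, m).2.+1%:R^-1 t'.
    by exists t'.
  have [c ct cy] := net y sy; exists c; split; last by exists (s, m).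
  by apply: He; have [_ _ -> _] := dY_metric; exact: lt_trans cy me.
have /choice[q Hq] : forall z, exists q, (exists q', z \in t q') -> z \in t q.
  move=> z; have [[q zq]|no] := pselect (exists q', z \in t q'); first by exists q.
  by exists ([::], 0%N) => /no.
exists (fun z => (q z, index z (t (q z)))) => z z'; rewrite !inE => Hz Hz' [qq].
have := Hq z' Hz'; rewrite -qq => z'q ii.
by rewrite -(nth_index z (Hq z Hz)) ii nth_index.
Qed.

End compact_valued_sieve.

(** * Cardinality of the dense set, and conclusion *)

(** For countable [D] everything is coded in [nat]; otherwise [D] is infinite and absorbs finite
    sequences by [infinite_seq_inj]. *)
Lemma card_seq_le (X Y : Type) (D : set X) (E : set Y)
    (h : Y -> seq (seq D) * nat * nat) :
  {in E &, injective h} -> countable E \/ (E #<= D)%card.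
Proof.
move=> hinj; have [Dct|Dnct] := boolP (countable D).
  left; have /countable_injP[f finj] := Dct.
  have f'inj : injective (fun x : D => f (val x)).
    by move=> x x' /finj e; apply: val_inj; apply: e; exact: valP.
  apply/countable_injP.
  pose k (z : Y) := let: (s, m, i) := h z in
    pickle ([seq [seq f (val x) | x <- l] | l <- s], m, i).
  exists k => z z' Ez Ez'; rewrite /k => e; apply: hinj => //.
  case: (h z) (h z') e => [[s m] i] [[s' m'] i'].
  by move=> /(pcan_inj pickleK)[/(inj_map (inj_map f'inj))-> -> ->].
right; have /infiniteP/card_leP[g] : infinite_set D.
  by apply: contra_not (negP Dnct); exact: finite_set_countable.
pose c (n : nat) : D := g (SigSub (in_setT n)).
have cinj : injective c.
  by move=> m n /inj; rewrite !in_setT => /(_ isT isT) [].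
have [k kinj] := infinite_seq_inj cinj.
(* Inner lists, then the outer one, collapse to points of [D]; [m] and [i] enter through [c], and
   [k] merges the three. *)
pose k' (z : Y) : X := let: (s, m, i) := h z in
  val (k [:: k (map k s); c m; c i]).
have k'inj : {in E &, injective k'}.
  move=> z z' Ez Ez'; rewrite /k' => e; apply: hinj => //.
  case: (h z) (h z') e => [[s m] i] [[s' m'] i'].
  by move=> /val_inj/kinj[/kinj/(inj_map kinj)-> /cinj-> /cinj->].
rewrite -(card_le_eql (inj_card_eq k'inj)); apply: subset_card_le => _ [z _ <-].
by rewrite /k'; case: (h z) => [[s m] i]; exact: set_valP.
Qed.

Theorem theorem1p2 (X Y : topologicalType)
  (mX : metrizable X) (mY : metrizable Y)
  (F : set X -> set Y)
  (F_compact : forall K : set X, compact K -> compact (F K))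
  (F_mono : forall K L : set X, compact K -> compact L -> K `<=` L -> F K `<=` F L)
  (F_2c : forall L : set Y, compact L -> countable L ->
     exists K : set X, compact K /\ L `<=` F K)
  (F_3c : forall (U : set X) (V : set Y), open U -> open V ->
     U !=set0 -> V !=set0 ->
     (forall L : set Y, compact L -> countable L -> L `<=` V ->
        exists K : set X, [/\ compact K, K `<=` U & L `<=` F K]) ->
     forall W : set (set X), (forall A, W A -> open A) ->
       U `<=` \bigcup_(A in W) A ->
     forall y : Y, V y ->
       exists (E : set (set X)) (Vy : set Y),
         [/\ finite_set E, E `<=` W, nbhs y Vy &
           forall L : set Y, compact L -> countable L -> L `<=` Vy ->
             exists K : set X, [/\ compact K, K `<=` \bigcup_(A in E) A & L `<=` F K]])
  (cX : completely_metrizable X) :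
  completely_metrizable Y /\ dens_le Y X.
Proof.
have [dX [dXm dXi dXc]] := cX; have [dY [dYm dYi]] := mY.
split=> [|D Dd].
  (* Nothing is counted here, so all points of [X] serve as centers. *)
  have Xd : dense (range (@id X)) by move=> G [x Gx] _; exists x; split=> //; exists x.
  exact: (image_completely_metrizable dXm dXi dXc dYm dYi F_compact F_mono
    F_2c F_3c Xd).
(* For the density, the centers are the points of [D], so that the nets are indexed by finite
   sequences over [D]. *)
have valD : dense (range (fun x : D => val x)).
  move=> G G0 Go; have [x [Gx Dx]] := Dd G G0 Go; exists x; split=> //.
  by exists (SigSub (mem_set Dx)).
have [E [Ed [h hinj]]] := dense_nets dXm dXi dXc dYm dYi F_compact F_mono
  F_2c F_3c valD.
by exists E; split=> //; exact: card_seq_le hinj.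
Qed.
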